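(* Let $\Phi$ be a root system with finite reflection group $\mathcal{W}=\mathcal{W}(\Phi)$, let $K$ be an arbitrary field, and let $\{J,J'\}$ be a good system in $\Phi$. Let $S^{\Delta,\Delta'}\subseteq M^{\Delta}$ be the associated generalized Specht module, and let $S^{\Delta,\Delta'^{\perp}}$ be its orthogonal complement in $M^{\Delta}$ with respect to the bilinear form $\langle\ ,\ \rangle$. Then the $K\mathcal{W}$-module $$D^{\Delta,\Delta'}=S^{\Delta,\Delta'}\big/\big(S^{\Delta,\Delta'}\cap S^{\Delta,\Delta'^{\perp}}\big)$$ is zero or irreducible.
   Context: Root systems and reflection groups. $V$ is a finite-dimensional real Euclidean space with positive definite inner product $(\ ,\ )$. For $0\ne\alpha\in V$, $\tau_\alpha(v)=v-2\frac{(\alpha,v)}{(\alpha,\alpha)}\alpha$ is the reflection in the hyperplane orthogonal to $\alpha$. $\Phi$ is a root system in $V$ (not necessarily crystallographic: a finite set of nonzero vectors with $\Phi\cap\mathbb{R}\alpha=\{\alpha,-\alpha\}$ and $\tau_\alpha\Phi=\Phi$ for all $\alpha\in\Phi$), with a fixed simple system $\pi$ and corresponding positive system $\Phi^+$. $\mathcal{W}=\mathcal{W}(\Phi)$ is the finite group generated by the $\tau_\alpha$, $\alpha\in\Phi$, with identity $e$. The sign of $w\in\mathcal{W}$ is $s(w)=(-1)^{l(w)}$, where $l$ is the length function with respect to $\{\tau_\alpha:\alpha\in\pi\}$. Subsystems. A subsystem of $\Phi$ is a subset $\Psi\subseteq\Phi$ that is itself a root system in the space it spans (the empty set is allowed).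 Subsystems are assumed additively closed: $\alpha,\beta\in\Psi$ and $\alpha+\beta\in\Phi$ imply $\alpha+\beta\in\Psi$. A simple system of a subsystem $\Psi$ can always be chosen inside $\Phi^+$. If $J\subset\Phi^+$ is a simple system of $\Psi$, write $\mathcal{W}(J)=\mathcal{W}(\Psi)$ for the subgroup of $\mathcal{W}$ generated by the $\tau_\alpha$, $\alpha\in\Psi$. $\Psi^\perp$ is the largest subsystem of $\Phi$ orthogonal to $\Psi$, and $J^\perp\subset\Phi^+$ is its simple system. Put $D_\Psi=\{w\in\mathcal{W}: w(j)\in\Phi^+\text{ for all }j\in J\}$, a set of representatives of the left cosets $w\mathcal{W}(\Psi)$ in $\mathcal{W}$. Useful systems. Let $\Psi,\Psi'$ be subsystems of $\Phi$ with simple systems $J,J'\subset\Phi^+$ and Dynkin (Coxeter) diagrams $\Delta,\Delta'$ respectively, such that $\Psi'\subseteq\Phi\setminus\Psi$. The pair $\{J,J'\}$ is a useful system in $\Phi$ if $\mathcal{W}(J)\cap\mathcal{W}(J')=\langle e\rangle$ and $\mathcal{W}(J^\perp)\cap\mathcal{W}(J'^{\perp})=\langle e\rangle$. Tableaux and tabloids. Let $\{J,J'\}$ be a useful system. Let $J=\bigcup_i J_i$ and $J'=\bigcup_k J'_k$ be the decompositions according to the indecomposable components of $\Psi$ and $\Psi'$, and let $\bar J=\{J_1,\dots,J_r;J'_1,\dots,J'_s\}$ be the ordered collection, the elements inside each $J_i$ and $J'_k$ also being ordered (all orders fixed). $\mathcal{W}$ acts on such ordered collections entrywise, and $w\bar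 J$ is also denoted $\overline{wJ}$. The elements of $\{w\bar J: w\in\mathcal{W}\}$ are the $\Delta$-tableaux (they are $|\mathcal{W}|$ in number). Two $\Delta$-tableaux $\overline{wJ}$ and $\bar L$ are row-equivalent if $\bar L=\rho\,\overline{wJ}$ for some $\rho\in\mathcal{W}(wJ)=w\mathcal{W}(J)w^{-1}$; the class of $\overline{wJ}$ is denoted $\{\overline{wJ}\}$ and called a $\Delta$-tabloid. The set of $\Delta$-tabloids is $\tau_\Delta=\{\{\overline{dJ}\}: d\in D_\Psi\}$, and $\mathcal{W}$ acts on it by $\sigma\{\overline{wJ}\}=\{\overline{\sigma wJ}\}$ (well defined). $M^\Delta$ is the $K$-vector space with basis $\tau_\Delta$, a $K\mathcal{W}$-module by linear extension. Specht modules. Set $\kappa_{J'}=\sum_{\sigma\in\mathcal{W}(J')}s(\sigma)\sigma\in K\mathcal{W}$ and $e_{J,J'}=\kappa_{J'}\{\bar J\}\in M^\Delta$. More generally, for $w\in\mathcal{W}$, $e_{wJ,wJ'}=\kappa_{wJ'}\{\overline{wJ}\}=w\,e_{J,J'}$, where $\kappa_{wJ'}=\sum_{\sigma\in w\mathcal{W}(J')w^{-1}}s(\sigma)\sigma$. The generalized Specht module $S^{\Delta,\Delta'}$ (also written $S^{J,J'}$) is the $K$-subspace of $M^\Delta$ spanned by all $e_{wJ,wJ'}$, $w\in\mathcal{W}$; it is a $K\mathcal{W}$-submodule. Good systems. A useful system $\{J,J'\}$ is a good system if for every $d\in D_\Psi$ with $d\Psi\cap\Psi'=\emptyset$, the tabloid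 $\{\overline{dJ}\}$ appears with non-zero coefficient in $e_{J,J'}$. Bilinear form. $\langle\ ,\ \rangle$ is the symmetric, non-singular, $\mathcal{W}$-invariant $K$-bilinear form on $M^\Delta$ for which the $\Delta$-tabloids are orthonormal: the form takes the value $1$ on a pair of equal tabloids and $0$ on a pair of distinct tabloids. $S^{\Delta,\Delta'^{\perp}}=\{m\in M^\Delta:\langle m,x\rangle=0\text{ for all }x\in S^{\Delta,\Delta'}\}$. *)

(* Defs.v *)
From HB Require Import structures.
From mathcomp Require Import all_boot all_order all_algebra.
From mathcomp Require Import all_classical reals.

Set Implicit Arguments.
Unset Strict Implicit.
Unset Printing Implicit Defensive.

Import Order.TTheory GRing.Theory Num.Theory.

Local Open Scope classical_set_scope.
Local Open Scope ring_scope.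

Section RootSystems.
Context {R : realType} {V : vectType R}.
Variable ip : {dot V for @idfun R}.
Implicit Types (Phi Psi A B C : set V) (J s : seq V) (w : 'End(V)).

Definition reflection_fun (a v : V) : V := v - (2 * (ip a v / ip a a)) *: a.

Lemma reflection_fun_is_linear (a : V) : linear (reflection_fun a).
Proof.
move=> c u v; rewrite /reflection_fun linearPr /=.
rewrite scalerBr scalerA addrACA -opprD -scalerDl; congr (_ + - (_ *: _)).
by rewrite (mulrDl (c * _)) mulrDr -(mulrA c) mulrCA.
Qed.

HB.instance Definition _ (a : V) :=
  GRing.isLinear.Build R V V *:%R (reflection_fun a) (reflection_fun_is_linear a).

Definition reflection (a : V) : 'End(V) := linfun (reflection_fun a).

Lemma reflectionE (a v : V) :
  reflection a v = v - (2 * (ip a v / ip a a)) *: a.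
Proof. by rewrite lfunE. Qed.

Definition root_system Phi : Prop :=
  [/\ finite_set Phi,
      forall a, Phi a -> a != 0,
      forall a, Phi a -> Phi `&` [set c *: a | c in [set: R]] = [set a; - a]
    & forall a, Phi a -> reflection a @` Phi = Phi].

Definition subsystem Phi Psi : Prop :=
  [/\ Psi `<=` Phi, root_system Psi
    & forall a b, Psi a -> Psi b -> Phi (a + b) -> Psi (a + b)].

Definition nonneg_comb J (v : V) : Prop :=
  exists c : V -> R, (forall a, 0 <= c a) /\ v = \sum_(a <- J) c a *: a.

(* Simple systems are enumerated; nothing below depends on the enumeration
   except the tableaux. *)
Definition simple_system Phi J : Prop :=
  [/\ [set` J] `<=` Phi, free J
    & forall a, Phi a -> nonneg_comb J a \/ nonneg_comb J (- a)].

Definition positive_system Phi J : set V := [set a | Phi a /\ nonneg_comb J a].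

Definition orthogonal_sets A B : Prop := forall a b, A a -> B b -> ip a b = 0.

(* The largest subsystem of Phi orthogonal to Psi; see [perp_largest]. *)
Definition perp Phi Psi : set V :=
  [set a | Phi a /\ forall b, Psi b -> ip a b = 0].

Definition refl_word s : 'End(V) :=
  foldr (fun a w => (reflection a \o w)%VF) \1%VF s.

(* The subgroup of GL(V) generated by the reflections in the elements of Psi:
   the generators being involutions, it consists of the words in them. *)
Definition refl_group Psi : set 'End(V) :=
  [set w | exists2 s, [set` s] `<=` Psi & w = refl_word s].

Definition has_word J w (n : nat) : Prop :=
  exists s, [/\ size s = n, [set` s] `<=` [set` J] & w = refl_word s].

Definition refl_length J w : nat :=
  [get n | has_word J w n /\ forall m, has_word J w m -> (n <= m)%N].

Definition refl_sign (K : fieldType) J w : K := (-1) ^+ refl_length J w.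

Definition conj_set w (H : set 'End(V)) : set 'End(V) :=
  [set (w \o (h \o w^-1))%VF | h in H].

(* D_Psi, where Pi is the simple system of Phi and J that of Psi *)
Definition coset_reps Phi Pi J : set 'End(V) :=
  [set w | refl_group Phi w /\ forall j, j \in J -> positive_system Phi Pi (w j)].

Definition indecomposable C : Prop :=
  C !=set0 /\
  forall A B, A `|` B = C -> orthogonal_sets A B -> A = set0 \/ B = set0.

Definition component Psi C : Prop :=
  [/\ C `<=` Psi, indecomposable C & orthogonal_sets C (Psi `\` C)].

(* Js lists, in some order and without repetition, the traces on J of the
   indecomposable components of Psi, each of them being itself listed in some
   order without repetition. *)
Definition ordered_decomposition Psi J (Js : seq (seq V)) : Prop :=
  [/\ perm_eq (flatten Js) J,
      forall L, L \in Js ->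
        exists2 C, component Psi C & [set` L] = [set` J] `&` C
    & forall C, component Psi C ->
        exists2 L, L \in Js & [set` L] = [set` J] `&` C].

Definition useful_system Phi Pi Psi Psi' J J' : Prop :=
  [/\ subsystem Phi Psi /\ subsystem Phi Psi',
      simple_system Psi J /\ simple_system Psi' J',
      [set` J] `<=` positive_system Phi Pi /\
        [set` J'] `<=` positive_system Phi Pi,
      Psi' `<=` Phi `\` Psi
    & refl_group Psi `&` refl_group Psi' = [set \1%VF] /\
        refl_group (perp Phi Psi) `&` refl_group (perp Phi Psi') = [set \1%VF]].

End RootSystems.

Definition tableau {R : realType} (V : vectType R) : Type :=
  (seq (seq V) * seq (seq V))%type.

Definition tableau_act {R : realType} {V : vectType R} (w : 'End(V))
    (T : tableau V) : tableau V :=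
  ([seq [seq w x | x <- L] | L <- T.1], [seq [seq w x | x <- L] | L <- T.2]).

Section Specht.
Context {R : realType} {V : vectType R}.
Variables (ip : {dot V for @idfun R}) (K : fieldType).
Variables (Phi : set V) (Pi : seq V) (Psi Psi' : set V) (J : seq V).
(* {J_1, ..., J_r; J'_1, ..., J'_s}, the two groups being kept apart *)
Variable Jbar : tableau V.
Implicit Types (t : set (tableau V)) (w sigma : 'End(V)).

Definition row_equiv (T L : tableau V) : Prop :=
  exists w, [/\ refl_group ip Phi w, T = tableau_act w Jbar
    & exists2 rho, conj_set w (refl_group ip Psi) rho & L = tableau_act rho T].

Definition tabloid (T : tableau V) : set (tableau V) := [set L | row_equiv T L].

(* sigma {wJ} = {sigma wJ}: the translate of a class, as a set of tableaux,
   is again a class. *)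
Definition tabloid_act sigma t : set (tableau V) := tableau_act sigma @` t.

Definition tabloids : set (set (tableau V)) :=
  [set tabloid (tableau_act d Jbar) | d in coset_reps ip Phi Pi J].

(* Formal K-linear combinations of tabloids are coefficient functions on all
   sets of tableaux which vanish off [tabloids]. As the reflection group and
   [tabloids] are finite, so are all the sums below. *)
Local Notation combination := (set (tableau V) -> K^o).

Definition tabloid_module : set combination :=
  [set x | forall t, ~ tabloids t -> x t = 0].

Definition basis_vector t : combination := fun u => (`[< u = t >] : nat)%:R.

Definition module_act sigma (x : combination) : combination :=
  \sum_(t \in tabloids) x t *: basis_vector (tabloid_act sigma t).

(* kappa_{wJ'} acting on the tabloid module; w = \1 gives kappa_{J'} *)
Definition kappa w (x : combination) : combination :=
  \sum_(sigma \in conj_set w (refl_group ip Psi'))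
     refl_sign ip K Pi sigma *: module_act sigma x.

(* e_{wJ,wJ'}; w = \1 gives e_{J,J'} *)
Definition specht_vector w : combination :=
  kappa w (basis_vector (tabloid (tableau_act w Jbar))).

Definition specht_module : set combination :=
  [set x | exists c : 'End(V) -> K,
     x = \sum_(w \in refl_group ip Phi) c w *: specht_vector w].

Definition tabloid_form (x y : combination) : K :=
  \sum_(t \in tabloids) x t * y t.

Definition specht_perp : set combination :=
  [set m | tabloid_module m /\
     forall x, specht_module x -> tabloid_form m x = 0].

(* [specht_vector \1] is e_{J,J'}, evaluated at the tabloid {dJ}. *)
Definition good_condition : Prop :=
  forall d, coset_reps ip Phi Pi J d ->
    [set d a | a in Psi] `&` Psi' = set0 ->
    specht_vector \1%VF (tabloid (tableau_act d Jbar)) != 0.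

End Specht.

Arguments tabloid_module {R V} ip K Phi Pi Psi J Jbar.
Arguments module_act {R V} ip K Phi Pi Psi J Jbar.
Arguments specht_vector {R V} ip K Phi Pi Psi Psi' J Jbar.
Arguments specht_module {R V} ip K Phi Pi Psi Psi' J Jbar.
Arguments specht_perp {R V} ip K Phi Pi Psi Psi' J Jbar.

Definition good_system {R : realType} {V : vectType R}
    (ip : {dot V for @idfun R}) (K : fieldType) (Phi : set V) (Pi : seq V)
    (Psi Psi' : set V) (J J' : seq V) (Jbar : tableau V) : Prop :=
  useful_system ip Phi Pi Psi Psi' J J' /\
  good_condition ip K Phi Pi Psi Psi' J Jbar.

(* X is a K-vector space, act a K-linear action on X of the elements of G,
   S a submodule of X and N a submodule of S. The operations of S/N are
   defined on cosets without choosing representatives; see [coset_addE],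
   [coset_scaleE] and [coset_actE]. *)
Section Quotient.
Context {K : fieldType} {X : lmodType K} {gT : Type}.
Variables (G : set gT) (act : gT -> X -> X) (S N : set X).
Implicit Types (C : set X) (U : set (set X)).

Definition submodule_of (A B : set X) : Prop :=
  [/\ A `<=` B, A 0, forall x y, A x -> A y -> A (x + y),
      forall (a : K) x, A x -> A (a *: x)
    & forall g x, G g -> A x -> A (act g x)].

Definition coset (x : X) : set X := [set x + n | n in N].

Definition quotient : set (set X) := [set coset x | x in S].

Definition coset_add C1 C2 : set X := [set x + y | x in C1 & y in C2].
Definition coset_scale (a : K) C : set X := [set a *: x + n | x in C & n in N].
Definition coset_act (g : gT) C : set X := [set act g x + n | x in C & n in N].

Definition quotient_submodule U : Prop :=
  [/\ U `<=` quotient, U (coset 0),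
      forall C1 C2, U C1 -> U C2 -> U (coset_add C1 C2),
      forall a C, U C -> U (coset_scale a C)
    & forall g C, G g -> U C -> U (coset_act g C)].

Definition quotient_zero : Prop := quotient = [set coset 0].

Definition quotient_irreducible : Prop :=
  ~ quotient_zero /\
  forall U, quotient_submodule U -> U = [set coset 0] \/ U = quotient.

Hypothesis N_sub : submodule_of N S.

Lemma coset_addE x y : coset_add (coset x) (coset y) = coset (x + y).
Proof.
have [_ N0 ND _ _] := N_sub.
rewrite eqEsubset; split=> z /=.
  by case=> _ [m Nm <-] [_ [n Nn <-] <-]; exists (m + n); [exact: ND|rewrite addrACA].
case=> n Nn <-; exists (x + 0); first by exists 0.
by exists (y + n); [exists n|rewrite addr0 addrA].
Qed.

Lemma coset_scaleE a x : coset_scale a (coset x) = coset (a *: x).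
Proof.
have [_ N0 ND NZ _] := N_sub.
rewrite eqEsubset; split=> z /=.
  case=> _ [m Nm <-] [n Nn <-]; exists (a *: m + n); last by rewrite scalerDr addrA.
  by apply: ND => //; exact: NZ.
case=> n Nn <-; exists (x + 0); first by exists 0.
by exists n => //; rewrite addr0.
Qed.

Hypothesis act_add : forall g, {morph act g : x y / x + y}.

Lemma coset_actE g x : G g -> coset_act g (coset x) = coset (act g x).
Proof.
move=> Gg; have [_ N0 ND _ NG] := N_sub.
rewrite eqEsubset; split=> z /=.
  case=> _ [m Nm <-] [n Nn <-]; exists (act g m + n); last by rewrite act_add addrA.
  by apply: ND => //; exact: NG.
case=> n Nn <-; exists (x + 0); first by exists 0.
by exists n => //; rewrite addr0.
Qed.

End Quotient.

Lemma perp_largest {R : realType} {V : vectType R} (ip : {dot V for @idfun R})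
    (Phi Psi : set V) : root_system ip Phi ->
  [/\ subsystem ip Phi (perp ip Phi Psi),
      orthogonal_sets ip (perp ip Phi Psi) Psi
    & forall Q, subsystem ip Phi Q -> orthogonal_sets ip Q Psi ->
        Q `<=` perp ip Phi Psi].
Proof.
move=> [finP nzP lineP reflP]; split.
- split=> [a []//| |a b [_ oa] [_ ob] Pab]; last first.
    by split=> // c Pc; rewrite linearDl /= oa ?ob ?addr0.
  have ss : perp ip Phi Psi `<=` Phi by move=> a [].
  have oN a : perp ip Phi Psi a -> perp ip Phi Psi (- a).
    move=> [Pa oa]; split; last by move=> b Pb; rewrite linearNl /= oa ?oppr0.
    have : [set a; - a] (- a) by right.
    by rewrite -lineP // => -[].
  have stab a b : perp ip Phi Psi a -> perp ip Phi Psi b ->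
      perp ip Phi Psi (reflection ip a b).
    move=> [Pa oa] [Pb ob]; split; first by rewrite -[Phi](reflP a) //; exists b.
    move=> c Pc; rewrite reflectionE linearBl /= (ob c) //.
    by rewrite linearZl_LR /= (oa c) // mulr0 subr0.
  split; first exact: sub_finite_set finP.
  + by move=> a /ss; exact: nzP.
  + move=> a Pa; rewrite eqEsubset; split=> b.
      by case=> /ss Pb Cb; rewrite -(lineP a) //; exact: ss.
    case=> ->; split=> //; first by exists 1; rewrite ?scale1r.
    * exact: oN.
    * by exists (-1); rewrite ?scaleN1r.
  + move=> a Pa; rewrite eqEsubset; split=> b; first by case=> c Pc <-; exact: stab.
    move=> Pb; exists (reflection ip a b); first exact: stab.
    have aa : ip a a != 0.
      by rewrite gt_eqF // neq0_dnorm_gt0 //; exact/nzP/ss.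
    rewrite !reflectionE linearBr /= linearZr_LR /=.
    rewrite mulrBl -(mulrA _ (ip a a)).
    rewrite mulfV // mulr1 -addrA -opprD -scalerDl.
    set x := ip a b / ip a a.
    suff -> : 2 * x + 2 * (x - 2 * x) = 0 by rewrite scale0r subr0.
    by rewrite -mulrDr addrA (mulr_natl x 2) mulr2n subrr mulr0.
- by move=> a b [_ oa]; exact: oa.
- by move=> Q [QP _ _] oQ a Qa; split; [exact: QP|move=> b; exact: oQ].
Qed.

(* Main.v *)
Require Import Defs.
From HB Require Import structures.
From mathcomp Require Import all_boot all_order all_algebra.
From mathcomp Require Import all_classical reals.
From mathcomp Require Import ring.

Set Implicit Arguments.
Unset Strict Implicit.
Unset Printing Implicit Defensive.

Import Order.TTheory GRing.Theory Num.Theory.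

Local Open Scope classical_set_scope.
Local Open Scope ring_scope.

(* James's submodule theorem. Let k be the alternating sum over W(J') and e the
   generator k{J} of S. If d Psi meets Psi', a reflection of W(J') fixes {dJ} and
   k{dJ} = 0; otherwise goodness yields {dJ} = s{J} with s in W(J'), and
   k{dJ} = sgn(s) e. So k maps M into the line K e. As k is self-adjoint for the
   form, a submodule T of S either has k x != 0 for some x in T, whence e lies in
   T and T = S, or k T = 0, whence T is orthogonal to the translates of e, which
   span S. *)

(** The sign is defined by the length of a shortest word in the simple reflections, a formula from
    which multiplicativity cannot be read off. It is therefore compared with the determinant, and
    the comparison requires that the simple reflections generate W. A second obstacle is that
    tabloids are indexed by D_Psi, which in general is not stable under left multiplication by W:
    that W permutes the tabloids rests on every coset w W(Psi) meeting D_Psi. Both facts come from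
    extremal choices, a root of least height in an orbit and an element of W(Psi) maximizing a
    linear functional on an orbit. Over an arbitrary K the form can be degenerate on S, which is why
    the quotient by the radical appears and why no argument may divide by 2. *)

Lemma finite_set_argmin {R : realDomainType} {T : choiceType} (A : set T)
    (f : T -> R) : finite_set A -> A !=set0 ->
  exists2 x, A x & forall y, A y -> f x <= f y.
Proof.
case/finite_seqP=> s ->; elim: s => [[]//|a s IH _].
have [s0|sn0] := eqVneq s [::].
  by exists a => [|y] /=; rewrite s0 ?mem_head // inE => /eqP ->.
have [|x /= xs minx] := IH.
  by case: s sn0 {IH} => // b s _; exists b; rewrite /= mem_head.
have [lexa|ltax] := leP (f x) (f a).
  by exists x => [|y] /=; rewrite inE ?xs ?orbT // => /orP[/eqP->|/minx].
exists a => [|y] /=; rewrite inE ?eqxx // => /orP[/eqP->//|/minx].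
exact: le_trans (ltW ltax).
Qed.

(** Both sides are the determinant of one block matrix, with unit diagonal blocks and off-diagonal
    blocks [v] and [u], eliminated along either diagonal block. A reflection is such a rank-one
    perturbation of the identity. *)
Lemma det_1_sub_mul {R : comNzRingType} n (u : 'cV[R]_n) (v : 'rV[R]_n) :
  \det (1%:M - u *m v) = 1 - (v *m u) 0 0.
Proof.
pose M := block_mx (1%:M : 'M_1) v u (1%:M : 'M_n).
have M1 : M = block_mx 1%:M 0 u 1%:M *m block_mx 1%:M v 0 (1%:M - u *m v).
  by rewrite mulmx_block !(mul1mx, mulmx1, mul0mx, mulmx0, addr0, add0r) addrC subrK.
have M2 : M = block_mx (1%:M - v *m u) v 0 1%:M *m block_mx 1%:M 0 u 1%:M.
  by rewrite mulmx_block !(mul1mx, mulmx1, mul0mx, mulmx0, addr0, add0r) subrK.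
have := congr1 determinant M1; rewrite M2 !det_mulmx !det_ublock !det_lblock.
by rewrite !det1 !(mul1r, mulr1) => <-; rewrite det_mx11 !mxE eqxx.
Qed.

(** * Determinants of endomorphisms and dual functionals *)

Section LfunDet.
Context {F : fieldType} {V : vectType F}.
Import VectorInternalTheory.

Definition lfun_det (w : 'End(V)) : F := \det (lin1_mx (v2r \o w \o r2v)).

Lemma lfun_det_comp (w w' : 'End(V)) :
  lfun_det (w \o w')%VF = lfun_det w * lfun_det w'.
Proof.
(* Matrices act on row vectors, so a composite corresponds to the product in the opposite order. *)
rewrite /lfun_det mulrC -det_mulmx; congr (\det _).
apply/row_matrixP => i; rewrite !rowE mulmxA !mul_rV_lin1 /=.
by rewrite comp_lfunE v2rK.
Qed.

Lemma lfun_det1 : lfun_det \1%VF = 1.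
Proof.
rewrite /lfun_det -[RHS](det1 _ (dim V)); congr (\det _).
by apply/row_matrixP => i; rewrite !rowE mul_rV_lin1 /= mulmx1 lfunE /= r2vK.
Qed.

Lemma lfun_det_transvection (f : 'Hom(V, F^o)) (a : V) (w : 'End(V)) :
  (forall v, w v = v - f v *: a) -> lfun_det w = 1 - f a.
Proof.
move=> wE; pose u : 'cV[F]_(dim V) := \col_i f (r2v (delta_mx 0 i)).
have fE x : f (r2v x) = (x *m u) 0 0.
  rewrite {1}(row_sum_delta x) !linear_sum /= mxE.
  by apply: eq_bigr => i _; rewrite !linearZ /= mxE.
rewrite /lfun_det -[a in RHS]v2rK fE -det_1_sub_mul; congr (\det _).
apply/row_matrixP => i; rewrite !rowE mul_rV_lin1 /= wE linearB linearZ /= r2vK.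
rewrite mulmxBr mulmx1 mulmxA; congr (_ - _).
by rewrite [X in _ = X *m _]mx11_scalar -fE mul_scalar_mx.
Qed.

(** Constant [c] yields the height function of a simple system, and the indicator of one element
    yields its coordinate. *)
Lemma free_dual (J : seq V) (c : V -> F) : free J ->
  exists f : 'Hom(V, F^o), forall b, b \in J -> f b = c b.
Proof.
move=> freeJ; pose X := in_tuple J.
exists (\sum_(i < size J) c J`_i *: linfun (coord X i : V -> F^o)) => b /(nthP 0)[k kJ <-].
rewrite sum_lfunE (bigD1 (Ordinal kJ)) //= scale_lfunE lfunE /=.
rewrite (coord_free (Ordinal kJ)) // eqxx big1 ?addr0; first exact: mulr1.
move=> i ik; rewrite scale_lfunE lfunE /= (coord_free (Ordinal kJ)) //.
by rewrite eq_sym (negbTE ik) scaler0.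
Qed.

End LfunDet.

(** * Reflections and the finite group they generate *)

Section ReflectionGroup.
Context {R : realType} {V : vectType R}.
Variable ip : {dot V for @idfun R}.
Implicit Types (Phi Psi Q : set V) (J s : seq V) (w g x : 'End(V)) (a u v : V).

Lemma ipC u v : ip u v = ip v u.
Proof. by rewrite hermC expr0 mul1r. Qed.

Lemma ip_eq0 u : ip u u = 0 -> u = 0.
Proof.
move=> u0; apply/eqP; apply: contraT => /(@neq0_dnorm_gt0 _ _ _ ip).
by rewrite u0 ltxx.
Qed.

Lemma reflection_isometry a u v :
  ip (reflection ip a u) (reflection ip a v) = ip u v.
Proof.
have [->|a0] := eqVneq a 0; first by rewrite !reflectionE !scaler0 !subr0.
have aa : ip a a != 0 by rewrite gt_eqF // neq0_dnorm_gt0.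
rewrite !reflectionE !linearBl /= !linearBr /= !linearZl_LR /= !linearZr_LR /=.
by rewrite (ipC u a); field.
Qed.

Lemma reflection_self a : reflection ip a a = - a.
Proof.
have [->|a0] := eqVneq a 0; first by rewrite linear0 oppr0.
have aa : ip a a != 0 by rewrite gt_eqF // neq0_dnorm_gt0.
by rewrite reflectionE divff // mulr1 scaler_nat mulr2n opprD addrA subrr sub0r.
Qed.

Lemma reflectionK a : (reflection ip a \o reflection ip a)%VF = \1%VF.
Proof.
apply/lfunP => v; rewrite comp_lfunE [RHS]lfunE /= [LHS]reflectionE.
have -> : ip a (reflection ip a v) = - ip a v.
  by rewrite -(reflection_isometry a a v) reflection_self linearNl opprK.
by rewrite reflectionE mulNr mulrN scaleNr opprK subrK.
Qed.

Lemma reflectionN a : reflection ip (- a) = reflection ip a.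
Proof.
apply/lfunP => v; rewrite !reflectionE !linearNl /= !linearNr /=.
by rewrite opprK mulNr mulrN scalerN scaleNr opprK.
Qed.

Lemma lfun_det_reflection a : a != 0 -> lfun_det (reflection ip a) = - 1.
Proof.
move=> a0; have aa : ip a a != 0 by rewrite gt_eqF // neq0_dnorm_gt0.
pose f : V -> R^o := fun v => 2 * (ip a v / ip a a).
have flin : linear f.
  by move=> c u v; rewrite /f linearPr /= /GRing.scale /=; ring.
pose L := HB.pack_for {linear V -> R^o} f (GRing.isLinear.Build R V R^o *:%R f flin).
rewrite (@lfun_det_transvection _ _ (linfun L) a).
  by rewrite lfunE /= /f divff //; ring.
by move=> v; rewrite reflectionE lfunE.
Qed.

Lemma refl_word_cat s s' :
  refl_word ip (s ++ s') = (refl_word ip s \o refl_word ip s')%VF.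
Proof.
by elim: s => [|a s IH] /=; rewrite ?comp_lfun1l // IH comp_lfunA.
Qed.

Lemma refl_group_ind Q (P : 'End(V) -> Prop) : P \1%VF ->
  (forall a w, Q a -> refl_group ip Q w -> P w -> P (reflection ip a \o w)%VF) ->
  forall w, refl_group ip Q w -> P w.
Proof.
move=> P1 PM _ [s sQ ->]; elim: s sQ => //= a s IH asQ.
have sQ : [set` s] `<=` Q by move=> b bs; apply: asQ => /=; rewrite inE bs orbT.
by apply: PM; [apply: asQ; rewrite /= mem_head|exists s|exact: IH].
Qed.

Lemma refl_group1 Q : refl_group ip Q \1%VF.
Proof. by exists [::]. Qed.

Lemma refl_groupM Q w w' :
  refl_group ip Q w -> refl_group ip Q w' -> refl_group ip Q (w \o w')%VF.
Proof.
move=> [s sQ ->] [s' s'Q ->]; exists (s ++ s'); last by rewrite refl_word_cat.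
by move=> a /=; rewrite mem_cat => /orP[/sQ|/s'Q].
Qed.

Lemma refl_group_reflection Q a : Q a -> refl_group ip Q (reflection ip a).
Proof.
move=> Qa; exists [:: a]; last by rewrite /= comp_lfun1r.
by move=> b; rewrite /= inE => /eqP ->.
Qed.

Lemma refl_group_gen Q Q' :
  (forall a, Q a -> refl_group ip Q' (reflection ip a)) ->
  refl_group ip Q `<=` refl_group ip Q'.
Proof.
move=> QQ' w; elim/refl_group_ind: w / => [|a w Qa _]; first exact: refl_group1.
by apply: refl_groupM; exact: QQ'.
Qed.

Lemma refl_groupS Q Q' : Q `<=` Q' -> refl_group ip Q `<=` refl_group ip Q'.
Proof. by move=> QQ'; apply: refl_group_gen => a /QQ'/refl_group_reflection. Qed.

Lemma refl_group_isometry Q w u v : refl_group ip Q w -> ip (w u) (w v) = ip u v.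
Proof.
move=> Ww; elim/refl_group_ind: w / Ww => [|a w _ _ IH]; first by rewrite !lfunE.
by rewrite !comp_lfunE reflection_isometry.
Qed.

Lemma refl_group_lker0 Q w : refl_group ip Q w -> lker w == 0%VS.
Proof.
move=> Ww; apply/lker0P => u v /eqP; rewrite -subr_eq0 -linearB => /eqP w0.
apply/eqP; rewrite -subr_eq0; apply/eqP/ip_eq0.
by rewrite -(refl_group_isometry _ _ Ww) w0 linear0l.
Qed.

Lemma refl_groupV Q w : refl_group ip Q w -> refl_group ip Q w^-1%VF.
Proof.
(* Since [w] is injective, any left inverse found inside the group is [w^-1]; it is built by
   reversing a word. *)
move=> Ww; suff [w' Ww' w'K] : exists2 w', refl_group ip Q w' & (w' \o w)%VF = \1%VF.
  suff -> : w^-1%VF = w' by [].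
  by rewrite -[RHS](lker0_compfK (refl_group_lker0 Ww)) w'K comp_lfun1l.
elim/refl_group_ind: w / Ww => [|a w Qa Ww [w' Ww' w'K]].
  by exists \1%VF; [exact: refl_group1|rewrite comp_lfun1l].
exists (w' \o reflection ip a)%VF.
  by apply: refl_groupM => //; exact: refl_group_reflection.
by rewrite comp_lfunA -(comp_lfunA w') reflectionK comp_lfun1r.
Qed.

Lemma isometry_reflection w a : (forall u v, ip (w u) (w v) = ip u v) ->
  (w \o reflection ip a = reflection ip (w a) \o w)%VF.
Proof.
move=> wi; apply/lfunP => v; rewrite !comp_lfunE !reflectionE !wi.
by rewrite linearB linearZ.
Qed.

(** Conjugating the reflection in [a] by the isometry [x] gives the reflection in [x a = a], so [x]
    commutes with every generator. This serves to control the elements that fix the tableau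
    [Jbar]. *)
Lemma refl_group_commute Q g x : (forall u v, ip (x u) (x v) = ip u v) ->
  (forall a, Q a -> x a = a) -> refl_group ip Q g -> (x \o g = g \o x)%VF.
Proof.
move=> xi xQ Wg; elim/refl_group_ind: g / Wg => [|a g Qa _ IH].
  by rewrite comp_lfun1r comp_lfun1l.
by rewrite comp_lfunA isometry_reflection // xQ // -!comp_lfunA IH.
Qed.

Lemma refl_group_root Phi w a :
  root_system ip Phi -> refl_group ip Phi w -> Phi a -> Phi (w a).
Proof.
move=> [_ _ _ rP] Ww Pa; elim/refl_group_ind: w / Ww => [|b w Pb _ IH].
  by rewrite lfunE.
by rewrite comp_lfunE -(rP b Pb); exists (w a).
Qed.

(* If g fixes the roots then, for all v, g v - v is a combination of roots
   that is orthogonal to them. *)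
Lemma refl_group_fix Q g :
  refl_group ip Q g -> (forall a, Q a -> g a = a) -> g = \1%VF.
Proof.
move=> Wg gQ; apply/lfunP => v; rewrite lfunE /=.
have gperp a : Q a -> ip a (g v - v) = 0.
  by move=> Qa; rewrite linearBr /= -{1}(gQ _ Qa) (refl_group_isometry _ _ Wg) subrr.
have orth y : (forall a, Q a -> ip a y = 0) ->
    forall w, refl_group ip Q w -> ip (w v - v) y = 0.
  move=> yQ w Ww; elim/refl_group_ind: w / Ww => [|a w Qa _].
    by rewrite lfunE /= subrr linear0l.
  rewrite !linearBl /= comp_lfunE reflectionE linearBl /= linearZl_LR /=.
  by rewrite (yQ _ Qa) mulr0 subr0 -linearBl.
by apply/eqP; rewrite -subr_eq0; apply/eqP/ip_eq0; exact: orth Wg.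
Qed.

(** By [refl_group_fix] an element is determined by its action on the finitely many roots. *)
Lemma refl_group_finite Phi : root_system ip Phi -> finite_set (refl_group ip Phi).
Proof.
move=> rP; have [/finite_seqP[s sE] _ _ _] := rP.
have Phi_s a : Phi a <-> a \in s by rewrite sE.
(* [F w] tabulates the permutation of the roots by their indices in [s]. These are below [size s];
   the extra value only provides the successor type that [inord] needs. *)
pose F w := [ffun i : 'I_(size s) => inord (index (w s`_i) s) : 'I_(size s).+1].
(* [G] chooses a group element with a given table, and the identity for tables that do not occur.
   The group is contained in its finite range. *)
pose G f := xget \1%VF [set w | refl_group ip Phi w /\ F w = f].
have finG : finite_set (range G) by apply/finite_image/finite_finset.
apply: sub_finite_set finG => w Ww; exists (F w) => //.
have := @xgetI _ \1%VF [set v | refl_group ip Phi v /\ F v = F w] w (conj Ww erefl).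
rewrite -/(G _) => -[]; move: (G _) => v Wv vw.
have -> : v = w; last by [].
have W1 : refl_group ip Phi (w^-1 \o v)%VF by apply: refl_groupM => //; exact: refl_groupV.
have wK := lker0_lfunK (refl_group_lker0 Ww).
suff : (w^-1 \o v)%VF = \1%VF.
  by move/(congr1 (comp_lfun w)); rewrite lker0_compVKf ?(refl_group_lker0 Ww) // comp_lfun1r.
apply: refl_group_fix W1 _ => a /Phi_s as_; rewrite comp_lfunE -[RHS]wK; congr (_ _).
have Ps x : refl_group ip Phi x -> x a \in s.
  by move=> Wx; apply/Phi_s; apply: refl_group_root => //; apply/Phi_s.
have is_ : (index a s < size s)%N by rewrite index_mem.
have := congr1 (fun f : {ffun _ -> _} => val (f (Ordinal is_))) vw.
rewrite !ffunE /= nth_index // !inordK ?ltnS ?index_size // => /(congr1 (nth 0 s)).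
by rewrite !nth_index ?Ps.
Qed.

End ReflectionGroup.

(** * Positive roots, the sign character and coset representatives *)

Section PositiveSystem.
Context {R : realType} {V : vectType R}.
Variable ip : {dot V for @idfun R}.
Implicit Types (Phi Psi : set V) (J Pi : seq V) (w : 'End(V)) (a b u v : V).

Lemma root_neq0 Phi a : root_system ip Phi -> Phi a -> a != 0.
Proof. by move=> [_ nz _ _]; exact: nz. Qed.

Lemma rootN Phi a : root_system ip Phi -> Phi a -> Phi (- a).
Proof.
case=> _ _ lineP _ Pa; have : [set a; - a] (- a) by right.
by rewrite -lineP // => -[].
Qed.

Lemma root_reflection Phi a b :
  root_system ip Phi -> Phi a -> Phi b -> Phi (reflection ip a b).
Proof.
by move=> rP Pa Pb; apply: (refl_group_root rP) => //; exact: refl_group_reflection.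
Qed.

Lemma positive_comb_gt0 J v (h : 'Hom(V, R^o)) :
  (forall b, b \in J -> h b = 1) -> nonneg_comb J v -> v != 0 -> 0 < h v.
Proof.
move=> hJ [c [c0 ->]] v0.
have hE : h (\sum_(b <- J) c b *: b) = \sum_(b <- J) c b.
  by rewrite linear_sum; apply: eq_big_seq => b bJ; rewrite linearZ /= hJ // [_ *: _]mulr1.
rewrite hE lt_neqAle sumr_ge0 // andbT eq_sym; apply: contra v0.
rewrite psumr_eq0 // => /allP cJ0; rewrite big_seq big1 // => b /cJ0/eqP ->.
by rewrite scale0r.
Qed.

(** The height function turns positivity of a root into the sign of a single linear functional. *)
Lemma positive_system_height Phi J : root_system ip Phi -> simple_system Phi J ->
  exists2 h : 'Hom(V, R^o), forall b, b \in J -> h b = 1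
    & forall a, Phi a -> h a != 0 /\ (positive_system Phi J a <-> 0 < h a).
Proof.
move=> rP [_ freeJ PJ]; have [h hJ] := free_dual (fun=> 1) freeJ.
exists h => // a Pa; have a0 := root_neq0 rP Pa.
have pos v : nonneg_comb J v -> v != 0 -> 0 < h v by exact: positive_comb_gt0.
have [pa|na] := PJ a Pa.
  by have ha := pos a pa a0; rewrite gt_eqF //; split.
have := pos _ na; rewrite oppr_eq0 linearN oppr_gt0 => /(_ a0) ha.
split; first by rewrite lt_eqF.
by split=> [[_ /pos/(_ a0)]|]; last by rewrite ltNge ltW.
Qed.

(** The reflection in [j] changes only the coefficient at [j]. A positive root other than [j] is not
    a multiple of [j], so it has another positive coefficient, which survives and prevents the image
    from being negative. *)
Lemma simple_reflection_positive Phi J j b :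
  root_system ip Phi -> simple_system Phi J -> j \in J ->
  positive_system Phi J b -> b != j -> positive_system Phi J (reflection ip j b).
Proof.
move=> rP sJ jJ [Pb [c [c0 bE]]] bj; have [JP freeJ PJ] := sJ.
have uJ := free_uniq freeJ; have Pj : Phi j by exact: JP.
have [h hJ hP] := positive_system_height rP sJ.
have h_b : 0 < h b by apply/(hP b Pb).2; split=> //; exists c.
have Ptb := root_reflection rP Pj Pb.
split; first exact: Ptb.
have [nb|[d [d0 dE]]] := PJ _ Ptb; first exact: nb.
have [[k kJ [kj ck]]|cj] : (exists2 k, k \in J & k != j /\ c k != 0) \/
    (forall k, k \in J -> k != j -> c k = 0).
- have [|/forall2NP nk] := pselect (exists2 k, k \in J & k != j /\ c k != 0).
    by left.
  right=> k kJ kj; apply/eqP/negP => ck; case: (nk k) => //.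
  by case; split=> //; exact/negP.
(* [f] reads off the coefficient at [k]. On the two expansions it gives [d k = - c k], against
   [0 <= d k] and [0 < c k]. *)
- have [f fJ] := free_dual (fun b => (b == k)%:R : R) freeJ.
  have fsum (e : V -> R) : f (\sum_(b <- J) e b *: b) = e k.
    rewrite linear_sum (bigD1_seq k) //= linearZ /= fJ // eqxx.
    rewrite big1_seq ?addr0; first exact: mulr1.
    by move=> i /andP[ik iJ]; rewrite linearZ /= fJ // (negbTE ik) scaler0.
  have := congr1 f dE; rewrite fsum reflectionE linearN linearB linearZ /= {1}bE.
  rewrite fsum fJ // eq_sym (negbTE kj) scaler0 subr0 => ckd.
  have := c0 k; rewrite le_eqVlt eq_sym (negbTE ck) /= => ck0.
  by have := d0 k; rewrite -ckd oppr_ge0 leNgt ck0.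
(* Here [b] is a multiple of [j], hence [j] or [- j], and the latter has height -1. *)
- exfalso; have bcj : b = c j *: j.
    rewrite bE (bigD1_seq j) //= big1_seq ?addr0 // => k /andP[kj kJ].
    by rewrite cj // scale0r.
  have : (Phi `&` [set x *: j | x in [set: R]]) b by split=> //; exists (c j).
  have [_ _ lineP _] := rP; rewrite lineP // => -[bj'|bj']; first by rewrite bj' eqxx in bj.
  by move: h_b; rewrite bj' linearN /= hJ // oppr_gt0 ltr10.
Qed.

(** Among the positive roots in the orbit of [b] under the simple reflections, one of least height
    is simple: otherwise some simple reflection lowers its height and keeps it positive. The
    reflection in [b] is then conjugate to a simple one. *)
Lemma refl_group_simple Phi Pi : root_system ip Phi -> simple_system Phi Pi ->
  refl_group ip Phi `<=` refl_group ip [set` Pi].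
Proof.
move=> rP sP; have [PiP _ _] := sP; have [h hPi hP] := positive_system_height rP sP.
apply: refl_group_gen.
suff pos b : positive_system Phi Pi b -> refl_group ip [set` Pi] (reflection ip b).
  move=> b Pb; have [_ _ /(_ b Pb)[]] := sP; first by move=> ?; exact: pos.
  by move=> nb; rewrite -reflectionN; apply: pos; split=> //; exact: rootN.
move=> pb; pose A := [set c | positive_system Phi Pi c /\
  exists2 w, refl_group ip [set` Pi] w & c = w b].
have finA : finite_set A by have [finP _ _ _] := rP; apply: sub_finite_set finP => c [[]].
have [|c [pc [w Ww cE]] minc] := finite_set_argmin h finA.
  by exists b; split=> //; exists \1%VF; [exact: refl_group1|rewrite lfunE].
have cPi : c \in Pi.
  apply: contraT => ncPi; have [Pc [x [x0 xE]]] := pc.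
  have cc : 0 < ip c c by apply: neq0_dnorm_gt0; exact: root_neq0 rP Pc.
  (* As [c] is a nonnegative combination of simple roots and [ip c c > 0], some simple root has
     positive product with [c]; reflecting in it subtracts a positive multiple of a vector of height
     1. *)
  have [a aPi ca] : exists2 a, a \in Pi & 0 < ip a c.
    apply: contrapT => /forall2NP na; move: cc; rewrite {1}xE linear_sumlz /= ltNge.
    rewrite big_seq sumr_le0 // => a aPi; rewrite linearZl_LR /= mulr_ge0_le0 //.
    by rewrite leNgt; apply/negP; case: (na a).
  have aa : 0 < ip a a by apply: neq0_dnorm_gt0; apply: (root_neq0 rP); exact: PiP.
  have Ata : A (reflection ip a c).
    split; first by apply: simple_reflection_positive => //; apply: contraNneq ncPi => ->.
    exists (reflection ip a \o w)%VF; last by rewrite comp_lfunE -cE.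
    by apply: refl_groupM => //; exact: refl_group_reflection.
  have := minc _ Ata; rewrite reflectionE linearB linearZ /= (hPi a) //.
  rewrite [_ *: _]mulr1 lerBDr gerDl leNgt.
  by rewrite mulr_gt0 ?divr_gt0.
have -> : reflection ip b = (w^-1 \o (reflection ip c \o w))%VF.
  rewrite cE -isometry_reflection ?(lker0_compKf (refl_group_lker0 Ww)) //.
  by move=> u v; exact: refl_group_isometry Ww.
apply: refl_groupM; first exact: refl_groupV.
by apply: refl_groupM => //; exact: refl_group_reflection.
Qed.

Lemma refl_word_det Phi s : root_system ip Phi -> [set` s] `<=` Phi ->
  lfun_det (refl_word ip s) = (-1) ^+ size s.
Proof.
move=> rP; elim: s => [|a s IH] sP /=; first exact: lfun_det1.
rewrite lfun_det_comp lfun_det_reflection; last first.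
  by apply: root_neq0 rP _; apply: sP; rewrite /= mem_head.
by rewrite IH ?exprS // => b bs; apply: sP; rewrite /= inE bs orbT.
Qed.

Lemma refl_group_det Phi w : root_system ip Phi -> refl_group ip Phi w ->
  lfun_det w = 1 \/ lfun_det w = -1.
Proof.
move=> rP [s sP ->]; rewrite (refl_word_det rP) // -signr_odd.
by case: odd; [right; rewrite expr1|left; rewrite expr0].
Qed.

(** A word of n reflections has determinant (-1)^n, which fixes the parity of a shortest simple
    word. The determinant lies in [R] and the sign in [K], where 1 and -1 may coincide; the boolean
    exponent carries one to the other. *)
Lemma refl_sign_det (K : fieldType) Phi Pi w :
  root_system ip Phi -> simple_system Phi Pi -> refl_group ip Phi w ->
  refl_sign ip K Pi w = (-1) ^+ (lfun_det w != 1).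
Proof.
move=> rP sP Ww; have [PiP _ _] := sP.
have [s sPi wE] := refl_group_simple rP sP Ww.
(* Because simple reflections generate the group, the [get] in the length has a witness and does not
   return its default. *)
have ex_n : exists n, `[< has_word ip Pi w n >] by exists (size s); apply/asboolP; exists s.
rewrite /refl_sign /refl_length; set n := get _.
have [[t [<- tPi ->]] _] : has_word ip Pi w n /\ forall m, has_word ip Pi w m -> (n <= m)%N.
  apply: (@getPex _ [set n | has_word ip Pi w n /\
    forall m, has_word ip Pi w m -> (n <= m)%N]).
  have [m /asboolP wm minm] := ex_minnP ex_n.
  by exists m; split=> // k /asboolP; exact: minm.
rewrite (refl_word_det rP); last exact: subset_trans tPi PiP.
rewrite -[in LHS]signr_odd -[(-1) ^+ size t in RHS]signr_odd.
by case: odd; rewrite ?expr0 ?eqxx // expr1 eqNr oner_eq0.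
Qed.

Lemma refl_signM (K : fieldType) Phi Pi w w' :
  root_system ip Phi -> simple_system Phi Pi ->
  refl_group ip Phi w -> refl_group ip Phi w' ->
  refl_sign ip K Pi (w \o w')%VF = refl_sign ip K Pi w * refl_sign ip K Pi w'.
Proof.
move=> rP sP Ww Ww'; rewrite !(refl_sign_det _ rP) //; last exact: refl_groupM.
rewrite lfun_det_comp -signr_addb; congr (_ ^+ _).
have N1 : (-1 == 1 :> R) = false by rewrite eqNr oner_eq0.
by case: (refl_group_det rP Ww) => ->; case: (refl_group_det rP Ww') => ->;
  rewrite ?mulr1 ?mulrNN ?mul1r ?eqxx ?N1.
Qed.

Lemma refl_sign1 (K : fieldType) Phi Pi : root_system ip Phi -> simple_system Phi Pi ->
  refl_sign ip K Pi \1%VF = 1.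
Proof.
move=> rP sP; rewrite (refl_sign_det _ rP) ?lfun_det1 ?eqxx //.
exact: refl_group1.
Qed.

Lemma refl_sign_reflection (K : fieldType) Phi Pi a :
  root_system ip Phi -> simple_system Phi Pi -> Phi a ->
  refl_sign ip K Pi (reflection ip a) = -1.
Proof.
move=> rP sP Pa; rewrite (refl_sign_det _ rP) //; last exact: refl_group_reflection.
by rewrite lfun_det_reflection ?(root_neq0 rP) // eqNr oner_eq0.
Qed.

Lemma refl_sign_sqr (K : fieldType) Phi Pi w :
  root_system ip Phi -> simple_system Phi Pi -> refl_group ip Phi w ->
  refl_sign ip K Pi w * refl_sign ip K Pi w = 1.
Proof. by move=> rP sP Ww; rewrite (refl_sign_det K rP sP Ww) -signr_addb addbb. Qed.

Lemma refl_signV (K : fieldType) Phi Pi w :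
  root_system ip Phi -> simple_system Phi Pi -> refl_group ip Phi w ->
  refl_sign ip K Pi w^-1%VF = refl_sign ip K Pi w.
Proof.
move=> rP sP Ww; have WV := refl_groupV Ww.
have := refl_signM K rP sP Ww WV; rewrite lker0_compfV ?(refl_group_lker0 Ww) //.
rewrite (refl_sign1 K rP sP) => /(congr1 (fun c => refl_sign ip K Pi w * c)).
by rewrite mulrA (refl_sign_sqr K rP sP Ww) mul1r mulr1.
Qed.

(** The reflection permutes the positive roots other than [j] and negates [j]. Here [rho] is the
    full sum of positive roots, twice the usual half-sum, whence the factor 2. *)
Lemma sum_positive_reflection Psi J j :
  root_system ip Psi -> simple_system Psi J -> j \in J ->
  let rho := \sum_(b \in positive_system Psi J) b in
  reflection ip j rho = rho - j *+ 2.
Proof.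
move=> rP sJ jJ rho; have [JP _ _] := sJ.
have finP : finite_set (positive_system Psi J).
  by have [fin _ _ _] := rP; apply: sub_finite_set fin => b [].
have [h hJ hP] := positive_system_height rP sJ.
have Pj := JP _ jJ; have pj : positive_system Psi J j by apply/(hP _ Pj).2; rewrite hJ.
have notNj : ~ positive_system Psi J (- j).
  by move=> /(hP _ (rootN rP Pj)).2; rewrite linearN /= hJ // ltr0N1.
have tK b : reflection ip j (reflection ip j b) = b.
  by rewrite -comp_lfunE reflectionK lfunE.
rewrite /rho (fsbigD1 j) // linearD /= reflection_self.
set S := \sum_(b \in _) b; suff -> : reflection ip j S = S.
  by rewrite mulr2n opprD addrACA subrr add0r addrC.
have finS : finite_set (positive_system Psi J `\ j) by exact: finite_setD.
rewrite {1}/S fsbig_finite // linear_sum -fsbig_finite //.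
rewrite /S; apply/esym; apply: reindex_fsbig.
have st b : (positive_system Psi J `\ j) b ->
    (positive_system Psi J `\ j) (reflection ip j b).
  move=> [pb bj]; split.
    by apply: simple_reflection_positive => //; exact/eqP.
  move=> tbj; apply: notNj; move: pb; rewrite -[b]tK tbj reflection_self.
  by [].
split=> //; first by move=> b c _ _ bc; rewrite -[b]tK bc tK.
by move=> b pb; exists (reflection ip j b); [exact: st|exact: tK].
Qed.

(** Choose [u] in W(Psi) maximizing the height of [w (u rho)]. Replacing [u] by [u] times the
    reflection in [j] lowers this height by twice that of [w (u j)], which is therefore nonnegative,
    and it is nonzero because [w (u j)] is a root. *)
Lemma coset_reps_exist Phi Pi Psi J w :
  root_system ip Phi -> simple_system Phi Pi ->
  subsystem ip Phi Psi -> simple_system Psi J -> refl_group ip Phi w ->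
  exists2 u, refl_group ip Psi u & coset_reps ip Phi Pi J (w \o u)%VF.
Proof.
move=> rP sP [PsiP rPsi _] sJ Ww; have [JPsi _ _] := sJ.
have [h hPi hP] := positive_system_height rP sP.
pose rho := \sum_(b \in positive_system Psi J) b.
have [|u Wu maxu] := finite_set_argmin
  (fun u : 'End(V) => - h (w (u rho))) (refl_group_finite rPsi).
  by exists \1%VF; exact: refl_group1.
have Wwu : refl_group ip Phi (w \o u)%VF.
  by apply: refl_groupM => //; apply: refl_groupS Wu.
exists u => //; split=> // j jJ; have Pj : Psi j by exact: JPsi.
have Pwuj : Phi ((w \o u)%VF j) by apply: (refl_group_root rP) => //; exact: PsiP.
have [nz pos] := hP _ Pwuj; apply/pos; rewrite lt_neqAle eq_sym nz /=.
have := maxu (u \o reflection ip j)%VF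
  (refl_groupM Wu (refl_group_reflection _ Pj)).
rewrite [(u \o _)%VF _]comp_lfunE (sum_positive_reflection rPsi) // -/rho.
by rewrite !linearB /= !raddfMn /= opprK lerDl pmulrn_lge0 // comp_lfunE.
Qed.

End PositiveSystem.

Lemma additive_fsum {I : choiceType} {X Y : nmodType} (f : X -> Y) (P : set I)
    (F : I -> X) : f 0 = 0 -> {morph f : x y / x + y} -> finite_set P ->
  f (\sum_(i \in P) F i) = \sum_(i \in P) f (F i).
Proof. by move=> f0 fD finP; rewrite !fsbig_finite // (big_morph f fD f0). Qed.

Lemma closed_fsum {I : choiceType} {X : nmodType} (A : set X) (P : set I)
    (F : I -> X) : A 0 -> (forall x y, A x -> A y -> A (x + y)) ->
  finite_set P -> (forall i, P i -> A (F i)) -> A (\sum_(i \in P) F i).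
Proof.
move=> A0 AD finP AF; rewrite fsbig_finite // big_seq.
by apply: big_ind => // i; rewrite in_fset_set // inE => /AF.
Qed.

(** * Irreducibility of a quotient from a dichotomy on submodules *)

Section Quotient.
Context {K : fieldType} {X : lmodType K} {gT : Type}.
Variables (G : set gT) (act : gT -> X -> X) (S N : set X).

Hypothesis act_add : forall g, {morph act g : x y / x + y}.
Hypothesis N_sub : submodule_of G act N S.
Hypothesis S_sub : submodule_of G act S S.
Hypothesis maxN : forall T, submodule_of G act T S -> S `<=` T \/ T `<=` N.

Lemma coset_mem x : N x -> coset N x = coset N 0.
Proof.
have [_ _ ND NZ _] := N_sub; move=> Nx; rewrite eqEsubset; split=> z [n Nn <-].
  by exists (x + n); [exact: ND|rewrite add0r].
exists (- x + n); last by rewrite addrA subrr.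
by apply: ND => //; rewrite -scaleN1r; exact: NZ.
Qed.

Lemma quotient_irreducible_or_zero : quotient_zero S N \/ quotient_irreducible G act S N.
Proof.
have [z|nz] := pselect (quotient_zero S N); [by left|right; split=> // U].
move=> [US U0 UD UZ UG]; have [_ S0 SD SZ SG] := S_sub.
(* [T] is the preimage of [U]: it contains S when [U] is the whole quotient, and lies in N when [U]
   is zero. *)
pose T := [set x | S x /\ U (coset N x)].
have T_sub : submodule_of G act T S.
  split=> [x []//| |x y [Sx Ux] [Sy Uy]|a x [Sx Ux]|g x Gg [Sx Ux]].
  - by split.
  - by split; [exact: SD|rewrite -(coset_addE N_sub); exact: UD].
  - by split; [exact: SZ|rewrite -(coset_scaleE N_sub); exact: UZ].
  - by split; [exact: SG|rewrite -(coset_actE N_sub act_add _ Gg); exact: UG].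
have [ST|TN] := maxN T_sub; [right|left]; rewrite eqEsubset; split=> //.
- by move=> _ [x /ST[_ Ux] <-].
- by move=> C UC; have [x Sx xC] := US _ UC; rewrite -xC; apply/coset_mem/TN; rewrite /T /= xC.
- by move=> _ ->.
Qed.

End Quotient.

(** * Tabloids and their permutation module *)

Section Tabloids.
Context {R : realType} {V : vectType R}.
Variables (ip : {dot V for @idfun R}) (K : fieldType).
Variables (Phi : set V) (Pi : seq V) (Psi Psi' : set V) (J : seq V).
Variable Jbar : tableau V.
Hypotheses (rPhi : root_system ip Phi) (sPi : simple_system Phi Pi).
Hypotheses (Psi_sub : subsystem ip Phi Psi) (sJ : simple_system Psi J).
Hypothesis Psi'Phi : Psi' `<=` Phi.
Hypothesis Jbar1 : perm_eq (flatten Jbar.1) J.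

Local Notation W := (refl_group ip Phi).
Local Notation WPsi := (refl_group ip Psi).
Local Notation WPsi' := (refl_group ip Psi').
Local Notation tab w := (tabloid ip Phi Psi Jbar (tableau_act w Jbar)).
Local Notation combination := (set (tableau V) -> K^o).
Local Notation tabs := (tabloids ip Phi Pi Psi J Jbar).
Local Notation M := (@tabloid_module R V ip K Phi Pi Psi J Jbar).
Local Notation A := (@module_act R V ip K Phi Pi Psi J Jbar).
Local Notation form := (@tabloid_form R V ip K Phi Pi Psi J Jbar).
Local Notation sgn := (refl_sign ip K Pi).
Implicit Types (w g s : 'End(V)) (t : set (tableau V)) (x y : combination).

Let WPsiS : WPsi `<=` W.
Proof. by apply: refl_groupS; case: Psi_sub. Qed.

Let WPsi'S : WPsi' `<=` W.
Proof. exact: refl_groupS. Qed.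

Let WVK w g : W w -> (w \o (w^-1 \o g))%VF = g.
Proof. by move=> Ww; rewrite (lker0_compVKf (refl_group_lker0 Ww)). Qed.

Let WKV w g : W w -> (w^-1 \o (w \o g))%VF = g.
Proof. by move=> Ww; rewrite (lker0_compKf (refl_group_lker0 Ww)). Qed.

Let WVw w : W w -> (w^-1 \o w)%VF = \1%VF.
Proof. by move=> Ww; rewrite (lker0_compVf (refl_group_lker0 Ww)). Qed.

Let WwV w : W w -> (w \o w^-1)%VF = \1%VF.
Proof. by move=> Ww; rewrite (lker0_compfV (refl_group_lker0 Ww)). Qed.

Let WV w : W w -> W w^-1%VF. Proof. exact: refl_groupV. Qed.
Let WM w g : W w -> W g -> W (w \o g)%VF. Proof. exact: refl_groupM. Qed.
Let W1 : W \1%VF. Proof. exact: refl_group1. Qed.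

Lemma tableau_act_comp w g (T : tableau V) :
  tableau_act (w \o g)%VF T = tableau_act w (tableau_act g T).
Proof.
rewrite /tableau_act /= -!map_comp.
by congr (_, _); apply: eq_map => L /=; rewrite -map_comp; apply: eq_map => v /=;
  rewrite comp_lfunE.
Qed.

Lemma tableau_act1 (T : tableau V) : tableau_act \1%VF T = T.
Proof.
have id1 (s : seq V) : map (\1%VF : 'End(V)) s = s.
  by rewrite (eq_map (g := id)) ?map_id // => v; rewrite lfunE.
case: T => T1 T2; rewrite /tableau_act /=.
by rewrite !(eq_map (g := id)) ?map_id.
Qed.

(** Fixing the tableau fixes the entries of its first group, which are the elements of [J], and
    these span Psi. *)
Lemma tableau_stab w a : tableau_act w Jbar = Jbar -> Psi a -> w a = a.
Proof.
move=> /(congr1 (fun T : tableau V => flatten T.1)) /=; rewrite -map_flatten => fixJ.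
have wJ j : j \in J -> w j = j.
  rewrite -(perm_mem Jbar1) => jF; have := fixJ; rewrite -[RHS]map_id.
  by move/eq_in_map/(_ _ jF).
have wcomb v : nonneg_comb J v -> w v = v.
  move=> [c [_ ->]]; rewrite linear_sum; apply: eq_big_seq => j jJ.
  by rewrite linearZ /= wJ.
move=> Pa; have [_ _ /(_ a Pa)[/wcomb //|/wcomb]] := sJ.
by rewrite linearN /= => /oppr_inj.
Qed.

(* Jbar may have a nontrivial stabilizer, but it centralizes WPsi, so
   the row equivalence does not depend on the w representing a tableau. *)
Lemma tabloidE w : W w -> tab w = [set tableau_act (w \o g)%VF Jbar | g in WPsi].
Proof.
move=> Ww; rewrite eqEsubset; split=> L.
  case=> w' [Ww' ww' [_ [g Wg <-] ->]]; exists g => //.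
  pose z := (w^-1 \o w')%VF.
  have zJ : tableau_act z Jbar = Jbar.
    by rewrite tableau_act_comp -ww' -tableau_act_comp WVw // tableau_act1.
  have Wz : W z by apply: WM => //; exact: WV.
  have zg : (z \o g = g \o z)%VF.
    apply: refl_group_commute Wg; first by move=> u v; exact: refl_group_isometry Wz.
    by move=> a Pa; exact: tableau_stab.
  rewrite ww' -tableau_act_comp -!comp_lfunA WVw // comp_lfun1r.
  by rewrite -[in LHS]zJ -tableau_act_comp -comp_lfunA -zg /z -comp_lfunA WVK.
case=> g Wg <-; exists w; split=> //; exists (w \o (g \o w^-1))%VF.
  by exists g.
by rewrite -tableau_act_comp -!comp_lfunA WVw // comp_lfun1r.
Qed.

Lemma tabloid_act_comp w g t : tabloid_act (w \o g)%VF t = tabloid_act w (tabloid_act g t).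
Proof.
rewrite /tabloid_act image_comp; apply: eq_imagel => T _ /=.
exact: tableau_act_comp.
Qed.

Lemma tabloid_act1 t : tabloid_act \1%VF t = t.
Proof.
rewrite /tabloid_act -[RHS]image_id; apply: eq_imagel => T _.
exact: tableau_act1.
Qed.

Lemma tabloid_actK w t : W w -> tabloid_act w^-1%VF (tabloid_act w t) = t.
Proof.
by move=> Ww; rewrite -tabloid_act_comp WVw // tabloid_act1.
Qed.

Lemma tabloid_actVK w t : W w -> tabloid_act w (tabloid_act w^-1%VF t) = t.
Proof.
by move=> Ww; rewrite -tabloid_act_comp WwV // tabloid_act1.
Qed.

Lemma tabloid_act_tab s w : W s -> W w -> tabloid_act s (tab w) = tab (s \o w)%VF.
Proof.
move=> Ws Ww; rewrite !tabloidE //; last exact: WM.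
rewrite /tabloid_act image_comp; apply: eq_imagel => g _ /=.
by rewrite -tableau_act_comp comp_lfunA.
Qed.

Lemma tab_row w g : W w -> WPsi g -> tab (w \o g)%VF = tab w.
Proof.
move=> Ww Wg; have Wg' := WPsiS Wg; rewrite !tabloidE //; last exact: WM.
rewrite eqEsubset; split=> _ [k Wk <-].
  by exists (g \o k)%VF; [exact: refl_groupM|rewrite comp_lfunA].
exists (g^-1 \o k)%VF; first by apply: refl_groupM => //; exact: refl_groupV.
by rewrite -comp_lfunA WVK.
Qed.

(** Indexing by all of W instead of D_Psi makes stability under left multiplication evident. *)
Lemma tabloids_tab t : tabs t <-> exists2 w, W w & t = tab w.
Proof.
split=> [[d [Wd _] <-]|[w Ww ->]]; first by exists d.
have [g Wg Dg] := coset_reps_exist rPhi sPi Psi_sub sJ Ww.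
by exists (w \o g)%VF => //; rewrite tab_row.
Qed.

Lemma tabloids_finite : finite_set tabs.
Proof.
have finW := refl_group_finite rPhi.
apply: sub_finite_set (finite_image (fun w => tab w) finW) => t /tabloids_tab[w Ww ->].
by exists w.
Qed.

Lemma tabloids_act s t : W s -> tabs t -> tabs (tabloid_act s t).
Proof.
move=> Ws /tabloids_tab[w Ww ->]; apply/tabloids_tab.
by exists (s \o w)%VF; [exact: WM|exact: tabloid_act_tab].
Qed.

Lemma tabloids_act_bij s : W s -> set_bij tabs tabs (tabloid_act s).
Proof.
move=> Ws; split; first by move=> t; exact: tabloids_act.
  by move=> t u _ _ tu; rewrite -(tabloid_actK t Ws) tu tabloid_actK.
move=> t tt; exists (tabloid_act s^-1%VF t); last exact: tabloid_actVK.
by apply: tabloids_act => //; exact: WV.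
Qed.

Lemma scale_basis_vector (a : K) t u :
  (a *: basis_vector K t) u = if `[< u = t >] then a else 0.
Proof.
have -> : (a *: basis_vector K t) u = a * basis_vector K t u by [].
by rewrite /basis_vector; case: ifP => _; rewrite ?mulr1 ?mulr0.
Qed.

Lemma module_act_act s x t : W s -> tabs t -> A s x (tabloid_act s t) = x t.
Proof.
move=> Ws tt; have finT := tabloids_finite.
rewrite /module_act (additive_fsum (f := fun y : combination => y _)) //.
rewrite (fsbigD1 t) // fsbig1 /=.
  by rewrite scale_basis_vector asboolT ?addr0.
move=> u [_ ut]; rewrite scale_basis_vector asboolF // => tu.
by case: ut; rewrite -(tabloid_actK u Ws) -tu tabloid_actK.
Qed.

Lemma module_act_module s x : W s -> M (A s x).
Proof.
move=> Ws t nt; rewrite /module_act (additive_fsum (f := fun y : combination => y t)) //.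
  rewrite fsbig1 // => u tu; rewrite scale_basis_vector asboolF // => tE.
  by case: nt; rewrite tE; exact: tabloids_act.
exact: tabloids_finite.
Qed.

(** Every tabloid is a translate by [s], so coefficients may be compared at translates, where
    [module_act_act] evaluates the action without inverses. *)
Lemma combination_eq s x y : W s -> M x -> M y ->
  (forall t, tabs t -> x (tabloid_act s t) = y (tabloid_act s t)) -> x = y.
Proof.
move=> Ws Mx My xy; apply/funext => t; have [tt|nt] := pselect (tabs t).
  rewrite -(tabloid_actVK t Ws); apply: xy.
  by apply: tabloids_act => //; exact: WV.
by rewrite Mx // My.
Qed.

Lemma module_act_add s : {morph A s : x y / x + y}.
Proof.
move=> x y; rewrite /module_act -fsbig_split /=; last exact: tabloids_finite.
by apply: eq_fsbigr => t _; rewrite -scalerDl.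
Qed.

Lemma module_act_scale s (a : K) x : A s (a *: x) = a *: A s x.
Proof.
rewrite /module_act (additive_fsum (f := fun y : combination => a *: y)).
- by apply: eq_fsbigr => t _; rewrite scalerA.
- exact: scaler0.
- by move=> u v; exact: scalerDr.
- exact: tabloids_finite.
Qed.

Lemma module_act0 s : A s 0 = 0.
Proof. by rewrite -[0 in LHS](scale0r 0) module_act_scale scale0r. Qed.

Lemma module_act_comp s g x : W s -> W g -> A (s \o g)%VF x = A s (A g x).
Proof.
move=> Ws Wg; have Wsg := WM Ws Wg.
apply: (combination_eq Wsg); [exact: module_act_module|exact: module_act_module|].
move=> t tt; rewrite module_act_act // tabloid_act_comp module_act_act //.
  by rewrite module_act_act.
exact: tabloids_act.
Qed.

Lemma basis_vector_module w : W w -> M (basis_vector K (tab w)).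
Proof.
move=> Ww t nt; rewrite /basis_vector; case: asboolP => // tE; case: nt; rewrite tE.
by apply/tabloids_tab; exists w.
Qed.

Lemma module_act_basis s w : W s -> W w ->
  A s (basis_vector K (tab w)) = basis_vector K (tab (s \o w)%VF).
Proof.
move=> Ws Ww; apply: (combination_eq Ws); first exact: module_act_module.
  by apply: basis_vector_module; exact: WM.
move=> t tt; rewrite module_act_act // /basis_vector -tabloid_act_tab //.
congr ((_ : nat)%:R); congr nat_of_bool; apply/asboolP/asboolP => [->//|tE].
by rewrite -(tabloid_actK t Ws) tE tabloid_actK.
Qed.

Lemma tabloid_form_act s x y : W s -> form (A s x) y = form x (A s^-1%VF y).
Proof.
move=> Ws; rewrite /tabloid_form (reindex_fsbig _ _ _ _ (tabloids_act_bij Ws)).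
apply: eq_fsbigr => t /set_mem tt; rewrite module_act_act //; congr (_ * _).
rewrite -{2}(tabloid_actK t Ws) module_act_act //; first exact: WV.
exact: tabloids_act.
Qed.

Lemma tabloid_form_addr x y z : form x (y + z) = form x y + form x z.
Proof.
rewrite /tabloid_form -fsbig_split /=; last exact: tabloids_finite.
by apply: eq_fsbigr => t _; rewrite -mulrDr.
Qed.

Lemma tabloid_form_scaler (a : K) x y : form x (a *: y) = a * form x y.
Proof.
rewrite /tabloid_form mulr_fsumr; apply: eq_fsbigr => t _.
by rewrite mulrCA.
Qed.

Lemma tabloid_formC x y : form x y = form y x.
Proof. by rewrite /tabloid_form; apply: eq_fsbigr => t _; rewrite mulrC. Qed.

Lemma tabloid_form0r x : form x 0 = 0.
Proof. by rewrite -(scale0r 0) tabloid_form_scaler mul0r. Qed.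

Lemma basis_vector_sum x : M x -> x = \sum_(t \in tabs) x t *: basis_vector K t.
Proof.
(* The expansion in the basis is, by the definition of the action, the identity acting on [x]. *)
have xE : A \1%VF x = \sum_(t \in tabs) x t *: basis_vector K t.
  by apply: eq_fsbigr => t _; rewrite tabloid_act1.
move=> Mx; rewrite -xE; apply: (combination_eq W1) => //; first exact: module_act_module.
by move=> t tt; rewrite module_act_act // tabloid_act1.
Qed.

(** * The alternating sum and the Specht module *)

Local Notation e := (@specht_vector R V ip K Phi Pi Psi Psi' J Jbar \1%VF).
Local Notation S := (@specht_module R V ip K Phi Pi Psi Psi' J Jbar).
Local Notation perpS := (@specht_perp R V ip K Phi Pi Psi Psi' J Jbar).
Local Notation b := (fun w => basis_vector K (tab w)).

Let finW : finite_set W. Proof. exact: refl_group_finite. Qed.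
Let finWPsi' : finite_set WPsi'. Proof. exact: sub_finite_set finW. Qed.

Lemma tabloid_moduleD x y : M x -> M y -> M (x + y).
Proof.
move=> Mx My t nt; have -> : (x + y) t = x t + y t by [].
by rewrite Mx // My // addr0.
Qed.

Lemma tabloid_moduleZ (a : K) x : M x -> M (a *: x).
Proof.
by move=> Mx t nt; have -> : (a *: x) t = a * x t by []; rewrite Mx // mulr0.
Qed.

(** This is [kappa] at the identity without the trivial conjugation, so the index set is literally a
    group and can be translated. *)
Definition alternating_sum x : combination :=
  \sum_(s \in WPsi') sgn s *: A s x.

Lemma alternating_sum_module x : M (alternating_sum x).
Proof.
apply: closed_fsum finWPsi' _ => [t _//|y z|s /WPsi'S Ws].
  exact: tabloid_moduleD.
by apply: tabloid_moduleZ; exact: module_act_module.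
Qed.

Lemma alternating_sum_add : {morph alternating_sum : x y / x + y}.
Proof.
move=> x y; rewrite /alternating_sum -fsbig_split //=.
by apply: eq_fsbigr => s _; rewrite module_act_add scalerDr.
Qed.

Lemma alternating_sum_scale (a : K) x : alternating_sum (a *: x) = a *: alternating_sum x.
Proof.
rewrite /alternating_sum (additive_fsum (f := fun y : combination => a *: y)) //.
- by apply: eq_fsbigr => s _; rewrite module_act_scale !scalerA mulrC.
- exact: scaler0.
- by move=> u v; exact: scalerDr.
Qed.

(** Conjugation by [w] matches the two index sets, and it preserves signs since the sign of [w]
    enters twice. *)
Lemma specht_vectorE w : W w ->
  specht_vector ip K Phi Pi Psi Psi' J Jbar w = A w (alternating_sum (b \1%VF)).
Proof.
move=> Ww; rewrite /specht_vector /kappa.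
rewrite (reindex_fsbig (fun g => (w \o (g \o w^-1))%VF) WPsi'); last first.
  split=> [g Wg|g k _ _ gk|_ [g Wg <-]]; [by exists g| |by exists g].
  have := congr1 (fun v => (w^-1 \o (v \o w))%VF) gk.
  by rewrite /= -!comp_lfunA WVw // !comp_lfun1r !WKV.
rewrite (additive_fsum _ (module_act0 w) (@module_act_add w)) //.
apply: eq_fsbigr => g /set_mem Wg; have Wg' := WPsi'S Wg.
have WwV' := WV Ww; have WgV := WM Wg' WwV'.
have Wwg := WM Ww Wg'; have WwgV := WM Ww WgV.
rewrite module_act_scale -!module_act_comp // !module_act_basis //.
rewrite !(refl_signM _ rPhi sPi) // (refl_signV _ rPhi sPi) //.
congr (_ *: basis_vector _ _); last by rewrite -!comp_lfunA WVw.
by rewrite mulrCA (refl_sign_sqr _ rPhi sPi) // mulr1.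
Qed.

Lemma specht_generator : e = alternating_sum (b \1%VF).
Proof.
rewrite specht_vectorE //; apply: (combination_eq W1); first exact: module_act_module.
  exact: alternating_sum_module.
by move=> t tt; rewrite module_act_act // tabloid_act1.
Qed.

Lemma specht_vector_act w : W w ->
  specht_vector ip K Phi Pi Psi Psi' J Jbar w = A w e.
Proof. by move=> Ww; rewrite specht_generator specht_vectorE. Qed.

(** Right translation by [s] permutes W(Psi'), and the square of the sign of [s] is 1. *)
Lemma alternating_sum_act s x : WPsi' s ->
  alternating_sum (A s x) = sgn s *: alternating_sum x.
Proof.
move=> Ws; have Ws' := WPsi'S Ws.
rewrite {2}/alternating_sum (reindex_fsbig (fun g => (g \o s)%VF) WPsi'); last first.
  split=> [g Wg|g k _ _ gk|g Wg]; first exact: refl_groupM.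
    have := congr1 (fun v => (v \o s^-1)%VF) gk.
    by rewrite /= -!comp_lfunA WwV // !comp_lfun1r.
  exists (g \o s^-1)%VF; first by apply: refl_groupM => //; exact: refl_groupV.
  by rewrite -comp_lfunA WVw // comp_lfun1r.
rewrite (additive_fsum (f := fun y : combination => sgn s *: y)) //.
- apply: eq_fsbigr => g /set_mem/WPsi'S Wg.
  rewrite module_act_comp // scalerA (refl_signM _ rPhi sPi) // mulrCA.
  by rewrite (refl_sign_sqr _ rPhi sPi) // mulr1.
- exact: scaler0.
- by move=> u v; exact: scalerDr.
Qed.

(* Over a field of characteristic 2, x = - x says nothing; instead the terms
   of s and s r cancel each other. *)
Lemma alternating_sum_fixed a x : Psi' a -> A (reflection ip a) x = x ->
  alternating_sum x = 0.
Proof.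
move=> Pa; set r := reflection ip a => rx.
have Wr : WPsi' r by exact: refl_group_reflection.
have Wr' := WPsi'S Wr.
have rK g : ((g \o r) \o r)%VF = g by rewrite -comp_lfunA reflectionK comp_lfun1r.
have detr : lfun_det r = -1 by apply: lfun_det_reflection; exact/(root_neq0 rPhi)/Psi'Phi.
have N1 : -1 <> 1 :> R by move/eqP; rewrite eqNr oner_eq0.
rewrite /alternating_sum (fsbigID [set g | lfun_det g = 1]) //=.
rewrite [X in _ + X](reindex_fsbig (fun g => (g \o r)%VF) (WPsi' `&` [set g | lfun_det g = 1])).
  rewrite -fsbig_split /=; last exact: finite_setIl.
  apply: fsbig1 => g [/WPsi'S Wg _].
  rewrite (refl_signM _ rPhi sPi) // module_act_comp // rx.
  rewrite (refl_sign_reflection _ rPhi sPi); last exact: Psi'Phi.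
  by rewrite mulrN1 scaleNr subrr.
split=> [g [Wg /= g1]|g k _ _ gk|g [Wg /= g1]].
- by split; [exact: refl_groupM|rewrite /= lfun_det_comp g1 mul1r detr].
- by rewrite -(rK g) gk rK.
- exists (g \o r)%VF; last exact: rK.
  split; first exact: refl_groupM.
  have [//|gN] := refl_group_det rPhi (WPsi'S Wg).
  by rewrite /= lfun_det_comp gN detr mulrNN mulr1.
Qed.

(** * Goodness and the submodule theorem *)

Hypothesis good : good_condition ip K Phi Pi Psi Psi' J Jbar.

Lemma alternating_sum_basis t : tabs t ->
  exists c : K, alternating_sum (basis_vector K t) = c *: e.
Proof.
move=> [d Dd <-]; have [Wd _] := Dd.
have [disj|] := pselect ([set d a | a in Psi] `&` Psi' = set0); last first.
  move=> /eqP/set0P[_ [[a Pa <-] Pda]]; exists 0; rewrite scale0r.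
  apply: (alternating_sum_fixed Pda); rewrite module_act_basis //; last first.
    by apply: refl_group_reflection; exact: Psi'Phi.
  (* Moved to the right of [d], the reflection in [d a] becomes the reflection in [a], a row
     operation that leaves the tabloid unchanged. *)
  rewrite -isometry_reflection; last by move=> u v; exact: refl_group_isometry Wd.
  by rewrite tab_row //; exact: refl_group_reflection.
(* A nonzero coefficient of [e] at [tab d] forces some term of the alternating sum to be supported
   there. *)
have [s Ws ds] : exists2 s, WPsi' s & tab d = tab s.
  have := good Dd disj; rewrite specht_generator /alternating_sum.
  rewrite (additive_fsum (f := fun y : combination => y (tab d))) //.
  apply: contraPP => /forall2NP ds; rewrite fsbig1 ?eqxx // => s Ws.
  have Ws' := WPsi'S Ws; rewrite module_act_basis // comp_lfun1r scale_basis_vector.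
  by rewrite asboolF //; case: (ds s).
exists (sgn s); have Ws' := WPsi'S Ws.
rewrite ds -{1}[s]comp_lfun1r -module_act_basis // alternating_sum_act //.
by rewrite specht_generator.
Qed.

Lemma alternating_sum_multiple x : M x -> exists c : K, alternating_sum x = c *: e.
Proof.
move=> Mx; rewrite (basis_vector_sum Mx).
rewrite (additive_fsum _ _ alternating_sum_add); last exact: tabloids_finite.
  apply: (@closed_fsum _ _ [set y | exists c : K, y = c *: e]).
  - by exists 0; rewrite scale0r.
  - by move=> _ _ [c ->] [c' ->]; exists (c + c'); rewrite scalerDl.
  - exact: tabloids_finite.
  - move=> t /alternating_sum_basis[c tE]; exists (x t * c).
    by rewrite alternating_sum_scale tE scalerA.
by rewrite -[0 in LHS](scale0r 0) alternating_sum_scale scale0r.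
Qed.

Lemma specht_ind (P : set combination) : P 0 ->
  (forall x y, P x -> P y -> P (x + y)) -> (forall (a : K) x, P x -> P (a *: x)) ->
  (forall w, W w -> P (A w e)) -> S `<=` P.
Proof.
move=> P0 PD PZ Pe _ [c ->]; apply: closed_fsum => // w Ww.
by rewrite specht_vector_act //; exact/PZ/Pe.
Qed.

Lemma specht_submodule : submodule_of W A S S.
Proof.
split=> [//| |_ _ [c ->] [d ->]|a _ [c ->]|g _ Wg [c ->]].
- by exists (fun=> 0); rewrite fsbig1 // => w _; rewrite scale0r.
- exists (c \+ d); rewrite -fsbig_split //=.
  by apply: eq_fsbigr => w _; rewrite scalerDl.
- exists (fun w => a * c w); rewrite (additive_fsum (f := fun y : combination => a *: y)) //.
  + by apply: eq_fsbigr => w _; rewrite scalerA.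
  + exact: scaler0.
  + by move=> u v; exact: scalerDr.
- exists (fun w => c (g^-1 \o w)%VF).
  rewrite (additive_fsum _ (module_act0 g) (@module_act_add g)) //.
  rewrite [RHS](reindex_fsbig (fun w => (g \o w)%VF) W).
    apply: eq_fsbigr => w /set_mem Ww; have Wgw := WM Wg Ww.
    by rewrite module_act_scale WKV // (specht_vector_act Ww) (specht_vector_act Wgw) module_act_comp.
  split=> [w Ww|w k _ _ wk|w Ww]; first exact: WM.
    by rewrite -(WKV w Wg) wk WKV.
  by exists (g^-1 \o w)%VF; [apply: WM => //; exact: WV|rewrite WVK].
Qed.

Lemma specht_perp_gen x : M x -> (forall w, W w -> form x (A w e) = 0) -> perpS x.
Proof.
move=> Mx xe; split=> // y; apply: (@specht_ind [set y | form x y = 0]) => //=.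
- exact: tabloid_form0r.
- by move=> u v xu xv; rewrite tabloid_form_addr xu xv addr0.
- by move=> a u xu; rewrite tabloid_form_scaler xu mulr0.
Qed.

Lemma specht_perp_submodule : submodule_of W A (S `&` perpS) S.
Proof.
have [_ S0 SD SZ SG] := specht_submodule.
split=> [x []//| |x y [Sx [Mx xS]] [Sy [My yS]]|a x [Sx [Mx xS]]|g x Wg [Sx [Mx xS]]].
- split=> //; split=> // x _; rewrite tabloid_formC; exact: tabloid_form0r.
- split; first exact: SD.
  split=> [|z Sz]; first exact: tabloid_moduleD.
  by rewrite tabloid_formC tabloid_form_addr tabloid_formC xS // tabloid_formC yS // addr0.
- split; first exact: SZ.
  split=> [|z Sz]; first exact: tabloid_moduleZ.
  by rewrite tabloid_formC tabloid_form_scaler tabloid_formC xS // mulr0.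
- split; first exact: SG.
  split=> [|z Sz]; first exact: module_act_module.
  by rewrite tabloid_form_act // xS //; apply: SG => //; exact: WV.
Qed.

(** Invariance of the form moves each group element across as its inverse; inversion permutes
    W(Psi') and preserves signs. *)
Lemma form_specht_generator x : form x e = form (alternating_sum x) (b \1%VF).
Proof.
rewrite specht_generator (tabloid_formC (alternating_sum x)) /alternating_sum.
rewrite !(additive_fsum _ (tabloid_form0r _) (tabloid_form_addr _)) //.
rewrite (reindex_fsbig (fun g : 'End(V) => g^-1%VF) WPsi').
  apply: eq_fsbigr => g /set_mem/WPsi'S Wg.
  rewrite !tabloid_form_scaler (refl_signV _ rPhi sPi) //; congr (_ * _).
  by rewrite -tabloid_form_act // tabloid_formC.
have VV g : WPsi' g -> (g^-1^-1)%VF = g.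
  move=> /WPsi'S Wg; have WgV := WV Wg.
  by rewrite -[RHS]comp_lfun1r -(WwV WgV) comp_lfunA WwV // comp_lfun1l.
split=> [g|g k /set_mem Wg /set_mem Wk gk|g Wg]; first exact: refl_groupV.
  by rewrite -(VV _ Wg) -(VV _ Wk) gk.
by exists g^-1%VF; [exact: refl_groupV|exact: VV].
Qed.

Lemma specht_submodule_dichotomy T : submodule_of W A T S ->
  S `<=` T \/ T `<=` S `&` perpS.
Proof.
move=> [TS T0 TD TZ TG].
have SM : S `<=` M.
  apply: specht_ind => [t _//|x y|a x|w Ww].
  - exact: tabloid_moduleD.
  - exact: tabloid_moduleZ.
  - exact: module_act_module.
have [[x Tx nz]|/forall2NP z] := pselect (exists2 x, T x & alternating_sum x != 0).
  left; have [c cE] := alternating_sum_multiple (SM _ (TS _ Tx)).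
  have Te : T e.
    (* The scalar [c] is invertible because the alternating sum of [x] is nonzero. *)
    have -> : e = c^-1 *: alternating_sum x.
      rewrite cE scalerA mulVf ?scale1r //; apply: contraNneq nz => c0.
      by rewrite cE c0 scale0r.
    apply: (TZ _ _); apply: closed_fsum => // s /WPsi'S Ws.
    by apply: TZ; exact: TG.
  by apply: specht_ind => // w Ww; exact: TG.
right=> x Tx; split; first exact: TS.
have Tz y : T y -> alternating_sum y = 0.
  by move=> Ty; apply/eqP; apply: contrapT => /negP ny; case: (z y).
apply: specht_perp_gen => [|w Ww]; first exact/SM/TS.
(* Pairing [x] with a translate of [e] is pairing with [e] the inverse translate of [x], which stays
   in [T] and is killed by the alternating sum. *)
have Wv := WV Ww; rewrite tabloid_formC tabloid_form_act // tabloid_formC.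
rewrite form_specht_generator Tz; last exact: TG.
by rewrite tabloid_formC tabloid_form0r.
Qed.

End Tabloids.

Theorem theorem3p23 (R : realType) (V : vectType R) (ip : {dot V for @idfun R})
    (Phi : set V) (Pi : seq V) (K : fieldType)
    (Psi Psi' : set V) (J J' : seq V) (Jbar : tableau V) :
  root_system ip Phi ->
  simple_system Phi Pi ->
  ordered_decomposition ip Psi J Jbar.1 ->
  ordered_decomposition ip Psi' J' Jbar.2 ->
  good_system ip K Phi Pi Psi Psi' J J' Jbar ->
  let S := specht_module ip K Phi Pi Psi Psi' J Jbar in
  let N := S `&` specht_perp ip K Phi Pi Psi Psi' J Jbar in
  quotient_zero S N \/
  quotient_irreducible (refl_group ip Phi)
    (module_act ip K Phi Pi Psi J Jbar) S N.
Proof.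
move=> rPhi sPi [Jbar1 _ _] _ [[[Psi_sub [Psi'Phi _ _]] [sJ _] _ _ _] good] S N.
apply: quotient_irreducible_or_zero.
- by move=> g; exact: (module_act_add rPhi sPi Psi_sub sJ Jbar1).
- exact: (specht_perp_submodule K rPhi sPi Psi_sub sJ Psi'Phi Jbar1).
- exact: (specht_submodule K rPhi sPi Psi_sub sJ Psi'Phi Jbar1).
- exact: (specht_submodule_dichotomy rPhi sPi Psi_sub sJ Psi'Phi Jbar1 good).
Qed.
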